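(* Under the antithesis translation: \begin{enumerate} \item An $\mathfrak L$-set is exactly an $\mathfrak I$-set $(A,=)$ equipped with an inequality relation, i.e. an $\mathfrak I$-relation $\neq$ on $A\times A$ such that $\neg(x\neq x)$ and $(x\neq y)\to(y\neq x)$ (i.e. it is irreflexive and symmetric). Here the $\mathfrak L$-equality is the pair $(x\circeq y)=\bigl((x=y),(x\neq y)\bigr)$. \item The $\mathfrak L$-set is strong if and only if $\neq$ is an apartness, i.e. $(x\neq z)\to(x\neq y)\vee(y\neq z)$. \item Its equality is affirmative if and only if $\neq$ is denial, i.e. $(x\neq y)\equiv\neg(x=y)$. \item Its equality is refutative if and only if $\neq$ is tight, i.e. $\neg(x\neq y)\equiv(x=y)$. \end{enumerate}
   Context: Intuitionistic ($\mathfrak I$-) side. We work in intuitionistic predicate logic over types. An $\mathfrak I$-set is a type $A$ with a predicate $=$ on $A\times A$ that is an equivalence relation. An $\mathfrak I$-relation on an $\mathfrak I$-set is a predicate $P$ on its underlying type that respects equality: $(x=y)\wedge P(x)\vdash P(y)$. The product of $\mathfrak I$-sets has componentwise equality. $\equiv$ denotes inter-derivability. Antithesis translation. An affine ($\mathfrak L$-) proposition is interpreted as a pair $P=(P^+,P^-)$ of intuitionistic propositions with $\neg(P^+\wedge P^-)$; likewise an $\mathfrak L$-predicate on a type $A$ is a pair of $\mathfrak I$-predicates on $A$ with $\neg(P^+(x)\wedge P^-(x))$ for all $x$. Types and terms are unchanged. An entailment $P\vdash Q$ of $\mathfrak L$-predicates means that both $P^+\vdash Q^+$ and $Q^-\vdash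 P^-$ hold intuitionistically, and $\vdash Q$ means $\top\vdash Q$, where $\top=(\mathbf 1,\mathbf 0)$ (true, false). The connectives used are $$P\boxtimes Q=(P^+\wedge Q^+,(P^+\to Q^-)\wedge(Q^+\to P^-)),\qquad P\sqcap Q=(P^+\wedge Q^+,P^-\vee Q^-),$$ $$!P=(P^+,\neg P^+),\qquad ?P=(\neg P^-,P^-).$$ $\mathfrak L$-sets. An $\mathfrak L$-set is a type $A$ with an $\mathfrak L$-predicate $\circeq$ on $A\times A$ satisfying (for all $x,y,z:A$) $\vdash x\circeq x$; $\ x\circeq y\vdash y\circeq x$; and $(x\circeq y)\boxtimes(y\circeq z)\vdash x\circeq z$. It is strong if moreover $(x\circeq y)\sqcap(y\circeq z)\vdash x\circeq z$. An $\mathfrak L$-proposition (or predicate) $P$ is affirmative if $P\equiv\,!P$ and refutative if $P\equiv\,?P$; ''its equality is affirmative/refutative'' means this of the predicate $\circeq$. *)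

(* Defs.v *)
From Stdlib Require Import RelationClasses RelationPairs.

Set Implicit Arguments.

(** Shallow embedding: intuitionistic propositions, predicates and
    derivability are [Prop], [Prop]-valued functions and (quantified)
    implication. *)

Record LProp : Type := MkLProp {
  pos : Prop;
  neg : Prop;
  consistent : ~ (pos /\ neg)
}.

Definition entails (P Q : LProp) : Prop :=
  (pos P -> pos Q) /\ (neg Q -> neg P).

Definition interderivable (P Q : LProp) : Prop :=
  entails P Q /\ entails Q P.

Definition ltop : LProp.
Proof. refine (@MkLProp True False _); tauto. Defined.

Definition valid (Q : LProp) : Prop := entails ltop Q.

Definition ltensor (P Q : LProp) : LProp.
Proof.
refine (@MkLProp (pos P /\ pos Q)
                 ((pos P -> neg Q) /\ (pos Q -> neg P)) _).
destruct P, Q; simpl; tauto.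
Defined.

Definition lmeet (P Q : LProp) : LProp.
Proof.
refine (@MkLProp (pos P /\ pos Q) (neg P \/ neg Q) _).
destruct P, Q; simpl; tauto.
Defined.

Definition lbang (P : LProp) : LProp.
Proof. refine (@MkLProp (pos P) (~ pos P) _); tauto. Defined.

Definition lwhynot (P : LProp) : LProp.
Proof. refine (@MkLProp (~ neg P) (neg P) _); tauto. Defined.

Definition affirmative (P : LProp) : Prop := interderivable P (lbang P).

Definition refutative (P : LProp) : Prop := interderivable P (lwhynot P).

(** Predicates on [A * A] are curried, and a judgment on predicates
    quantifies over their arguments. *)
Definition is_lset (A : Type) (E : A -> A -> LProp) : Prop :=
  (forall x, valid (E x x)) /\
  (forall x y, entails (E x y) (E y x)) /\
  (forall x y z, entails (ltensor (E x y) (E y z)) (E x z)).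

Definition is_strong_lset (A : Type) (E : A -> A -> LProp) : Prop :=
  is_lset E /\
  (forall x y z, entails (lmeet (E x y) (E y z)) (E x z)).

Definition affirmative_eq (A : Type) (E : A -> A -> LProp) : Prop :=
  forall x y, affirmative (E x y).

Definition refutative_eq (A : Type) (E : A -> A -> LProp) : Prop :=
  forall x y, refutative (E x y).

Definition pos_rel (A : Type) (E : A -> A -> LProp) : A -> A -> Prop :=
  fun x y => pos (E x y).

Definition neg_rel (A : Type) (E : A -> A -> LProp) : A -> A -> Prop :=
  fun x y => neg (E x y).

Definition lpair (A : Type) (e n : A -> A -> Prop)
    (d : forall x y, ~ (e x y /\ n x y)) : A -> A -> LProp :=
  fun x y => MkLProp (d x y).

Definition is_iset (A : Type) (e : A -> A -> Prop) : Prop := Equivalence e.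

Definition is_irelation (A : Type) (e : A -> A -> Prop) (P : A -> Prop) : Prop :=
  forall x y, e x y /\ P x -> P y.

(** [RelProd e e] is the componentwise equality on [A * A]. *)
Definition is_inequality (A : Type) (e n : A -> A -> Prop) : Prop :=
  is_irelation (RelProd e e) (fun p => n (fst p) (snd p)) /\
  (forall x, ~ n x x) /\
  (forall x y, n x y -> n y x).

(** The remaining properties are meant for [n] already an inequality. *)
Definition is_apartness (A : Type) (n : A -> A -> Prop) : Prop :=
  forall x y z, n x z -> n x y \/ n y z.

Definition is_denial (A : Type) (e n : A -> A -> Prop) : Prop :=
  forall x y, n x y <-> ~ e x y.

Definition is_tight (A : Type) (e n : A -> A -> Prop) : Prop :=
  forall x y, ~ n x y <-> e x y.

(* Main.v *)
From Stdlib Require Import RelationClasses RelationPairs.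
Require Import Defs.

(** Each clause comes from unfolding an entailment into its forward half on
    positive parts and its backward half on negative parts.

    The positive halves of the axioms of an L-set say that the positive part is
    an equivalence relation; the negative half of symmetry is symmetry of the
    negative part, and irreflexivity holds because a proposition whose positive
    part is true has a false negative part.  The substantial point is the
    negative half of transitivity: because the refutation of a tensor is a pair
    of implications, it reads
      [x # z -> (x = y -> y # z) /\ (y = z -> x # y)],
    which is exactly substitutivity of [#] in each of its two arguments
    ([neg_substl], [neg_substr]), hence respect for the componentwise equality.
    Conversely, substitutivity gives back this half of transitivity, and with
    irreflexivity it makes [=] and [#] incompatible ([inequality_disjoint]).

    For strength, the tensor is replaced by the meet, whose refutation is a
    disjunction, so the same half becomes the apartness axiom.  The last two
    clauses already hold for each single proposition
    ([affirmative_iff], [refutative_iff]). *)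

(** One of the two entailments between [P] and [!P] always holds, since the
    parts of [P] are incompatible; only [~ P^+ -> P^-] has content. *)
Lemma affirmative_iff (P : LProp) : affirmative P <-> (neg P <-> ~ pos P).
Proof.
unfold affirmative, interderivable, entails; simpl.
pose proof (consistent P); tauto.
Qed.

(** Dual to [affirmative_iff]: only [~ P^- -> P^+] has content. *)
Lemma refutative_iff (P : LProp) : refutative P <-> (~ neg P <-> pos P).
Proof.
unfold refutative, interderivable, entails; simpl.
pose proof (consistent P); tauto.
Qed.

Section FromLSet.

Variables (A : Type) (E : A -> A -> LProp).
Hypothesis HE : is_lset E.

Lemma lset_pos_equivalence : is_iset (pos_rel E).
Proof.
destruct HE as (Hrefl & Hsym & Htrans).
split.
- intros x; exact (proj1 (Hrefl x) I).
- intros x y; exact (proj1 (Hsym x y)).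
- intros x y z Hxy Hyz; exact (proj1 (Htrans x y z) (conj Hxy Hyz)).
Qed.

(** The first component of a refutation of the tensor. *)
Lemma neg_substl x x' y : pos_rel E x x' -> neg_rel E x y -> neg_rel E x' y.
Proof.
destruct HE as (_ & _ & Htrans).
intros Hx Hn; exact (proj1 (proj2 (Htrans x x' y) Hn) Hx).
Qed.

(** The second component of a refutation of the tensor; transitivity is used
    through [y'], so the equality comes out reversed. *)
Lemma neg_substr x y y' : pos_rel E y' y -> neg_rel E x y -> neg_rel E x y'.
Proof.
destruct HE as (_ & _ & Htrans).
intros Hy Hn; exact (proj2 (proj2 (Htrans x y' y) Hn) Hy).
Qed.

Lemma lset_neg_inequality : is_inequality (pos_rel E) (neg_rel E).
Proof.
pose proof lset_pos_equivalence as Heq; destruct Heq as [_ Hposym _].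
destruct HE as (Hrefl & Hsym & _).
split; [|split].
- intros [x y] [x' y'] [[Hx Hy] Hn].
  apply neg_substr with y; [exact (Hposym _ _ Hy)|].
  exact (neg_substl x x' y Hx Hn).
- intros x; exact (proj2 (Hrefl x)).
- intros x y; exact (proj2 (Hsym y x)).
Qed.

Lemma strong_iff_apartness : is_strong_lset E <-> is_apartness (neg_rel E).
Proof.
split.
- intros [_ Hstrong] x y z; exact (proj2 (Hstrong x y z)).
- intros Hap; split; [exact HE|].
  (* Meet and tensor have the same positive part. *)
  intros x y z; split; [|exact (Hap x y z)].
  destruct HE as (_ & _ & Htrans); exact (proj1 (Htrans x y z)).
Qed.

End FromLSet.

(** If [x = y] and [x # y], substituting [y] for [x] gives [y # y]. *)
Lemma inequality_disjoint (A : Type) (e n : A -> A -> Prop) :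
  is_iset e -> is_inequality e n -> forall x y, ~ (e x y /\ n x y).
Proof.
intros [Hrefl _ _] (Hresp & Hirr & _) x y [Hxy Hn].
apply (Hirr y), (Hresp (x, y) (y, y)).
exact (conj (conj Hxy (Hrefl y)) Hn).
Qed.

Lemma lset_of_inequality (A : Type) (e n : A -> A -> Prop)
    (d : forall x y, ~ (e x y /\ n x y)) :
  is_iset e -> is_inequality e n -> is_lset (lpair e n d).
Proof.
intros [Hrefl Hsym Htrans] (Hresp & Hirr & Hnsym).
split; [|split].
- intros x; split; [intros _; exact (Hrefl x)|exact (Hirr x)].
- intros x y; split; [exact (Hsym x y)|exact (Hnsym y x)].
- intros x y z; split; simpl.
  + intros [Hxy Hyz]; exact (Htrans x y z Hxy Hyz).
  + (* Each component substitutes in one argument and fixes the other. *)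
    intros Hn; split; intros He.
    * apply (Hresp (x, z) (y, z)); exact (conj (conj He (Hrefl z)) Hn).
    * apply (Hresp (x, z) (x, y)).
      exact (conj (conj (Hrefl x) (Hsym y z He)) Hn).
Qed.

Theorem theorem6p4 (A : Type) :
  ((forall E : A -> A -> LProp,
      is_lset E ->
      is_iset (pos_rel E) /\ is_inequality (pos_rel E) (neg_rel E)) /\
   (forall e n : A -> A -> Prop,
      is_iset e -> is_inequality e n ->
      exists d : (forall x y, ~ (e x y /\ n x y)), is_lset (lpair e n d))) /\
  (forall E : A -> A -> LProp,
     is_lset E ->
     (is_strong_lset E <-> is_apartness (neg_rel E)) /\
     (affirmative_eq E <-> is_denial (pos_rel E) (neg_rel E)) /\
     (refutative_eq E <-> is_tight (pos_rel E) (neg_rel E))).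
Proof.
split; [split|].
- intros E HE; split.
  + exact (lset_pos_equivalence A E HE).
  + exact (lset_neg_inequality A E HE).
- intros e n He Hn.
  exists (inequality_disjoint A e n He Hn).
  exact (lset_of_inequality A e n _ He Hn).
- intros E HE; split; [exact (strong_iff_apartness A E HE)|split].
  + split; intros H x y; apply affirmative_iff, H.
  + split; intros H x y; apply refutative_iff, H.
Qed.
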